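(* Let $x_{\rm e},y_{\rm e},u_{\rm e},x_{\rm o},y_{\rm o},u_{\rm o},p_{-1},q_{-1},p_{-2},q_{-2},p_{+1},p_{+2},\lambda$ be indeterminates and for $n,k\ge0$ let $$\widehat Q_{n,k}=\sum_{G\in\mathbf{LD}^{\rm alt\infty}_{n,k}}x_{\rm e}^{A_{\rm e}(G)}y_{\rm e}^{V_{\rm e}(G)}u_{\rm e}^{B_{\rm e}(G)}x_{\rm o}^{A_{\rm o}(G)}y_{\rm o}^{V_{\rm o}(G)}u_{\rm o}^{B_{\rm o}(G)}\,p_{-1}^{C_{\rm e}(G)}q_{-1}^{N_{\rm e}(G)}p_{+2}^{L_{\rm e}(G)}\,p_{-2}^{C_{\rm o}(G)}q_{-2}^{N_{\rm o}(G)}p_{+1}^{L_{\rm o}(G)}\,\lambda^{\mathrm{cyc}(G)}.$$ Let $\boldsymbol\alpha=(\alpha_m)_{m\ge1}$ with, for $m\ge1$, $$\alpha_{2m-1}=(\lambda+2m-2)\bigl(p_{-1}^{2m-2}x_{\rm e}+q_{-1}[2m-2]_{p_{-1},q_{-1}}u_{\rm e}\bigr)p_{+1}^{2m-2}y_{\rm o},$$ $$\alpha_{2m}=(\lambda+2m-1)\bigl(p_{-2}^{2m-1}x_{\rm o}+q_{-2}[2m-1]_{p_{-2},q_{-2}}u_{\rm o}\bigr)p_{+2}^{2m-1}y_{\rm e}.$$ Then for all $n,k\ge0$, $$\widehat Q_{2n,2k}=p_{+1}^{k(k-1)}p_{+2}^{k^2}\,y_{\rm e}^ky_{\rm o}^k\,S_{n,k}(\boldsymbol\alpha),\qquad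 \widehat Q_{2n+1,2k+1}=p_{+1}^{k(k+1)}p_{+2}^{k^2}\,y_{\rm e}^ky_{\rm o}^{k+1}\,S'_{n,k}(\boldsymbol\alpha).$$
   Context: $[m]_{p,q}=\sum_{j=0}^{m-1}p^jq^{m-1-j}$. $S_{n,k}(\boldsymbol\alpha)$ is the generating polynomial of lattice paths in $\mathbb Z\times\mathbb N$ from $(0,0)$ to $(2n,2k)$ with steps $(1,1)$ (weight 1) and $(1,-1)$ (weight $\alpha_i$ when falling from height $i$); $S'_{n,k}(\boldsymbol\alpha)$ likewise for paths to $(2n+1,2k+1)$. A Laguerre digraph on $[n]$ is a directed graph on $[n]$ (loops allowed) with all in- and out-degrees in $\{0,1\}$; components are directed paths (isolated vertices included) and directed cycles (loops included); $\mathrm{cyc}(G)$ = number of cycles. With $\infty$–$\infty$ boundary conditions, $p(i)$ is the predecessor of $i$ (or $\infty$ if in-degree 0), $s(i)$ the successor (or $\infty$ if out-degree 0), $\infty$ exceeding all integers. $i$ is a peak if $p(i)<i>s(i)$, valley if $p(i)>i<s(i)$, double ascent if $p(i)<i<s(i)$, double descent if $p(i)>i>s(i)$, fixed point if $p(i)=i=s(i)$. $G$ is alternating if it has none of the last three kinds; $\mathbf{LD}^{\rm alt\infty}_{n,k}$ = set of alternating Laguerre digraphs on $[n]$ with exactly $k$ paths. In the predecessor word $p(1)\cdots p(n)$, a letter $v$ is a record value if $v=p(i)$ for some $i$ with $p(j)<p(i)$ for all $j<i$. For $k\in[n]$: $\mathrm{lcross}(k,G)=\#\{(i,j,l): i,j\in[n],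 l\in[n]\cup\{\infty\}, i<j<k<l, p(i)=k, p(j)=l\}$, $\mathrm{lnest}(k,G)=\#\{(i,j,l): i,j\in[n], l\in[n]\cup\{\infty\}, i<j<k<l, p(j)=k, p(i)=l\}$; for $j\in[n]$: $\mathrm{ulev}(j,G)=\#\{i\in[n]: i<j<s(i)\}$ if $j<s(j)$ and $0$ otherwise. $A_{\rm e}(G)$ = number of even peaks that are record values of the predecessor word; $B_{\rm e}(G)$ = number of even peaks that are not; $V_{\rm e}(G)$ = number of even valleys; $C_{\rm e}(G)=\sum\mathrm{lcross}(k,G)$ and $N_{\rm e}(G)=\sum\mathrm{lnest}(k,G)$ over even peaks $k$; $L_{\rm e}(G)=\sum\mathrm{ulev}(j,G)$ over even valleys $j$; the subscript-o versions use odd vertices. *)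

(* Defs.v *)
From mathcomp Require Import all_boot all_order all_algebra.
Set Implicit Arguments.
Unset Strict Implicit.
Unset Printing Implicit Defensive.
Import GRing.Theory.

(* A digraph on [n] is its set of edges; the vertices 1, ..., n are encoded
   as 0, ..., n-1 in 'I_n, so the label of i is i.+1 (this matters only for
   parities). *)
Definition digraph (n : nat) := {set 'I_n * 'I_n}.

Definition label (n : nat) (i : 'I_n) : nat := i.+1.
Definition even_vertex (n : nat) : pred 'I_n := fun i => ~~ odd (label i).
Definition odd_vertex (n : nat) : pred 'I_n := fun i => odd (label i).

Definition laguerre (n : nat) (G : digraph n) : bool :=
  [forall i : 'I_n, (#|[set j | (i, j) \in G]| <= 1)
                    && (#|[set j | (j, i) \in G]| <= 1)].

Definition adj (n : nat) (G : digraph n) : rel 'I_n :=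
  fun i j => ((i, j) \in G) || ((j, i) \in G).

Definition components (n : nat) (G : digraph n) : {set {set 'I_n}} :=
  [set [set j | connect (adj G) i j] | i : 'I_n].

(* The induced subdigraph on C is the path s_0 -> s_1 -> ... -> s_(m-1). *)
Definition is_dipath (n : nat) (G : digraph n) (C : {set 'I_n}) : bool :=
  [exists s : #|C|.-tuple 'I_n, ([set x in s] == C) &&
     [forall a : 'I_#|C|, forall b : 'I_#|C|,
        ((tnth s a, tnth s b) \in G) == (b == a.+1 :> nat)]].

(* The induced subdigraph on C is the cycle s_0 -> ... -> s_(m-1) -> s_0;
   for m = 1 this is a loop. *)
Definition is_dicycle (n : nat) (G : digraph n) (C : {set 'I_n}) : bool :=
  [exists s : #|C|.-tuple 'I_n, ([set x in s] == C) &&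
     [forall a : 'I_#|C|, forall b : 'I_#|C|,
        ((tnth s a, tnth s b) \in G) == (b == a.+1 %% #|C| :> nat)]].

Definition npaths (n : nat) (G : digraph n) : nat :=
  #|[set C in components G | is_dipath G C]|.
Definition cyc (n : nat) (G : digraph n) : nat :=
  #|[set C in components G | is_dicycle G C]|.

(* The extended vertex set [n] with infinity is option 'I_n, None being
   infinity. *)
Definition ltv (n : nat) (u v : option 'I_n) : bool :=
  match u, v with
  | Some i, Some j => i < j
  | Some _, None => true
  | None, _ => false
  end.

Definition prv (n : nat) (G : digraph n) (i : 'I_n) : option 'I_n :=
  [pick j | (j, i) \in G].
Definition nxt (n : nat) (G : digraph n) (i : 'I_n) : option 'I_n :=
  [pick j | (i, j) \in G].

Definition peak (n : nat) (G : digraph n) (i : 'I_n) : bool :=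
  ltv (prv G i) (Some i) && ltv (nxt G i) (Some i).
Definition valley (n : nat) (G : digraph n) (i : 'I_n) : bool :=
  ltv (Some i) (prv G i) && ltv (Some i) (nxt G i).
Definition double_ascent (n : nat) (G : digraph n) (i : 'I_n) : bool :=
  ltv (prv G i) (Some i) && ltv (Some i) (nxt G i).
Definition double_descent (n : nat) (G : digraph n) (i : 'I_n) : bool :=
  ltv (Some i) (prv G i) && ltv (nxt G i) (Some i).
Definition fixed_point (n : nat) (G : digraph n) (i : 'I_n) : bool :=
  (prv G i == Some i) && (nxt G i == Some i).

Definition alternating (n : nat) (G : digraph n) : bool :=
  [forall i : 'I_n, [&& ~~ double_ascent G i, ~~ double_descent G i
                      & ~~ fixed_point G i]].

Definition LDalt (n k : nat) : {set digraph n} :=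
  [set G : digraph n | [&& laguerre G, alternating G & npaths G == k]].

Definition record_value (n : nat) (G : digraph n) (v : option 'I_n) : bool :=
  [exists i : 'I_n, (v == prv G i) &&
     [forall j : 'I_n, (j < i) ==> ltv (prv G j) (prv G i)]].

Definition lcross (n : nat) (G : digraph n) (k : 'I_n) : nat :=
  #|[set t : 'I_n * 'I_n * option 'I_n |
      let: (i, j, l) := t in
      [&& i < j, j < k, ltv (Some k) l, prv G i == Some k & prv G j == l]]|.

Definition lnest (n : nat) (G : digraph n) (k : 'I_n) : nat :=
  #|[set t : 'I_n * 'I_n * option 'I_n |
      let: (i, j, l) := t in
      [&& i < j, j < k, ltv (Some k) l, prv G j == Some k & prv G i == l]]|.

Definition ulev (n : nat) (G : digraph n) (j : 'I_n) : nat :=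
  if ltv (Some j) (nxt G j)
  then #|[set i : 'I_n | (i < j) && ltv (Some j) (nxt G i)]|
  else 0.

(* In the following statistics, c is the parity class of vertices. *)
Definition statA (n : nat) (c : pred 'I_n) (G : digraph n) : nat :=
  #|[set i | [&& c i, peak G i & record_value G (Some i)]]|.
Definition statB (n : nat) (c : pred 'I_n) (G : digraph n) : nat :=
  #|[set i | [&& c i, peak G i & ~~ record_value G (Some i)]]|.
Definition statV (n : nat) (c : pred 'I_n) (G : digraph n) : nat :=
  #|[set i | c i && valley G i]|.
Definition statC (n : nat) (c : pred 'I_n) (G : digraph n) : nat :=
  \sum_(k | c k && peak G k) lcross G k.
Definition statN (n : nat) (c : pred 'I_n) (G : digraph n) : nat :=
  \sum_(k | c k && peak G k) lnest G k.
Definition statL (n : nat) (c : pred 'I_n) (G : digraph n) : nat :=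
  \sum_(j | c j && valley G j) ulev G j.

(* A lattice path with N steps is a word w of booleans: true is a rise (1,1),
   false a fall (1,-1). The subtraction in ht is truncated, which is harmless
   for paths that stay in Z x N. *)
Definition rises (w : seq bool) : nat := count id w.
Definition falls (w : seq bool) : nat := count negb w.
Definition ht (w : seq bool) (t : nat) : nat :=
  rises (take t w) - falls (take t w).

Definition lattice_path (N H : nat) (w : N.-tuple bool) : bool :=
  [forall t : 'I_N.+1, falls (take t w) <= rises (take t w)] && (ht w N == H).

Local Open Scope ring_scope.

Definition path_weight (R : comNzRingType) (alpha : nat -> R) (N : nat)
    (w : N.-tuple bool) : R :=
  \prod_(t < N | ~~ tnth w t) alpha (ht w t).

Definition path_gf (R : comNzRingType) (alpha : nat -> R) (N H : nat) : R :=
  \sum_(w : N.-tuple bool | lattice_path H w) path_weight alpha w.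

Definition S_poly (R : comNzRingType) (alpha : nat -> R) (n k : nat) : R :=
  path_gf alpha (2 * n) (2 * k).
Definition S'_poly (R : comNzRingType) (alpha : nat -> R) (n k : nat) : R :=
  path_gf alpha (2 * n + 1) (2 * k + 1).

Definition pq_int (R : comNzRingType) (p q : R) (m : nat) : R :=
  \sum_(j < m) p ^+ j * q ^+ (m - 1 - j).

(* The suffixes m1, m2, p1, p2 stand for the subscripts -1, -2, +1, +2. *)
Definition Qhat (R : comNzRingType)
    (xe ye ue xo yo uo pm1 qm1 pm2 qm2 pp1 pp2 lambda : R) (n k : nat) : R :=
  let e := @even_vertex n in
  let o := @odd_vertex n in
  \sum_(G in LDalt n k)
    xe ^+ statA e G * ye ^+ statV e G * ue ^+ statB e G *
    xo ^+ statA o G * yo ^+ statV o G * uo ^+ statB o G *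
    pm1 ^+ statC e G * qm1 ^+ statN e G * pp2 ^+ statL e G *
    pm2 ^+ statC o G * qm2 ^+ statN o G * pp1 ^+ statL o G *
    lambda ^+ cyc G.

(* Main.v *)
(* Removing the largest vertex n+1 from an alternating Laguerre digraph leaves
   an alternating Laguerre digraph. Conversely, n+1 can be inserted into a
   digraph G with h paths either as an isolated valley, giving h+1 paths and the
   weight y p_+^h; or as a peak a -> n+1 -> b with a one of the h sinks and b one
   of the h sources, giving h-1 paths. If b has rank r among the sources, then
   lcross(n+1) = h-1-r, lnest(n+1) = r, and n+1 is a record value iff r = 0; a
   new cycle is closed iff a and b are the two ends of the same path, which
   happens for exactly one a. Summing over a and b gives the linear recurrence in
   (n, k) that, up to a product of valley weights, the generating polynomials of
   the lattice paths satisfy. *)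
Require Import Defs.
From mathcomp Require Import all_boot all_order all_algebra.
From mathcomp Require Import zify ring.
Set Implicit Arguments.
Unset Strict Implicit.
Unset Printing Implicit Defensive.
Import GRing.Theory.

(** * Components of a Laguerre digraph *)

Definition source (n : nat) (G : digraph n) : pred 'I_n := fun i => prv G i == None.
Definition sink (n : nat) (G : digraph n) : pred 'I_n := fun i => nxt G i == None.

Lemma laguerreP (n : nat) (G : digraph n) :
  reflect ((forall i j k, (i, j) \in G -> (i, k) \in G -> j = k) /\
           (forall i j k, (j, i) \in G -> (k, i) \in G -> j = k))
          (laguerre G).
Proof.
apply: (iffP forallP) => [H | [H1 H2] i].
  by split=> i j k Hj Hk; have /andP[/card_le1_eqP Hn /card_le1_eqP Hp] := H i;
    [apply: Hn | apply: Hp]; rewrite inE.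
apply/andP; split; apply/card_le1_eqP=> j k; rewrite !inE => Hj Hk.
  exact: H1 Hk Hj.
exact: H2 Hk Hj.
Qed.

Section Structure.
Variables (n : nat) (G : digraph n).
Hypothesis lagG : laguerre G.

Lemma prvE i j : (prv G j == Some i) = ((i, j) \in G).
Proof.
have [_ H] := laguerreP _ lagG.
rewrite /prv; case: pickP => [k Hk | H0]; last by rewrite H0.
by apply/eqP/idP => [[<-] // | Hi]; congr Some; apply: H Hk Hi.
Qed.

Lemma nxtE i j : (nxt G i == Some j) = ((i, j) \in G).
Proof.
have [H _] := laguerreP _ lagG.
rewrite /nxt; case: pickP => [k Hk | H0]; last by rewrite H0.
by apply/eqP/idP => [[<-] // | Hi]; congr Some; apply: H Hk Hi.
Qed.

(** * The permutation that closes each path into a cycle *)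

Definition backward (x : 'I_n) : 'I_n := odflt x (prv G x).
Definition forward (x : 'I_n) : 'I_n := odflt x (nxt G x).
(** A path has at most [n] vertices and [backward] stays at a source, so [n] steps from any vertex
    of a path end at its head. *)
Definition path_head (x : 'I_n) : 'I_n := iter n backward x.
(* Joining the end of each path to its head turns [G] into a permutation whose
   orbits are the components of [G]. *)
Definition closing (x : 'I_n) : 'I_n := odflt (path_head x) (nxt G x).

Lemma backwardK x : ~~ source G x -> nxt G (backward x) = Some x.
Proof.
rewrite /source /backward; case E: (prv G x) => [y|] //= _.
by apply/eqP; rewrite nxtE -prvE E.
Qed.

Lemma closingE x : ~~ sink G x -> nxt G x = Some (closing x).
Proof. by rewrite /sink /closing; case: (nxt G x). Qed.

Lemma closing_sink x : sink G x -> closing x = path_head x.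
Proof. by rewrite /sink /closing => /eqP ->. Qed.

Lemma backward_source x k : source G x -> iter k backward x = x.
Proof. by move=> /eqP Hx; elim: k => //= k ->; rewrite /backward Hx. Qed.

Lemma forward_sink x k : sink G x -> iter k forward x = x.
Proof. by move=> /eqP Hx; elim: k => //= k ->; rewrite /forward Hx. Qed.

(** Otherwise the backward iterates meet no source and must repeat. As [nxt] undoes [backward] away
    from sources, the repetition can be pulled back to [x] itself, which would then have a
    successor. *)
Lemma source_path_head_sink x : sink G x -> source G (path_head x).
Proof.
move=> sx.
have Hle : order backward x <= n by rewrite -[X in _ <= X]card_ord max_card.
suff [k Hk Hs] : exists2 k, k <= n & source G (iter k backward x).
  have -> : path_head x = iter (n - k + k) backward x by rewrite subnK.
  by rewrite iterD backward_source.
have /trajectP[i Hi Ei] := looping_order backward x.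
set m := order _ _ in Hle Hi Ei.
case: (boolP [exists k : 'I_n.+1, source G (iter k backward x)]) => [/existsP[k Hk] | H0].
  by exists k; rewrite // -ltnS.
have NS k : k <= n -> ~~ source G (iter k backward x).
  move=> Hk; move: H0; rewrite negb_exists => /forallP /(_ (Ordinal (Hk : k < n.+1))) //.
(* Cancels [j] common backward steps: [nxt] recovers a vertex that is not a source from its
   predecessor. *)
have main d j : d + j <= m -> iter (d + j) backward x = iter j backward x ->
    iter d backward x = x.
  elim: j => [|j IH]; first by rewrite addn0.
  rewrite addnS => Hd E; apply: IH; first exact: ltnW.
  have H1 := NS (d + j) (leq_trans (ltnW Hd) Hle).
  have Hj : j <= m by lia.
  have H2 := NS j (leq_trans Hj Hle).
  have := backwardK H1; rewrite -iterS E => E1.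
  by have := backwardK H2; rewrite -iterS E1 => -[].
have E0 : iter (m - i) backward x = x.
  by apply: (main _ i); rewrite subnK // ltnW.
have Hmi : 0 < m - i by rewrite subn_gt0.
move: E0; rewrite -(prednK Hmi) => E0.
have H1 := NS (m - i).-1 ltac:(lia).
have := backwardK H1; rewrite -iterS E0 => E1.
by move: sx; rewrite /sink E1.
Qed.

Lemma forward_path_head x : exists i, x = iter i forward (path_head x).
Proof.
suff H k : exists i, x = iter i forward (iter k backward x) by exact: H.
elim: k => [|k [i IH]]; first by exists 0.
rewrite iterS; set y := iter k backward x in IH *.
case: (boolP (source G y)) => [sy | /backwardK E].
  by exists i; have /= -> := backward_source 1 sy.
by exists i.+1; rewrite iterSr {2}/forward E.
Qed.

(** Forward steps lead from the common head to both sinks; the one reached first is fixed by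
    [forward], so the other coincides with it. *)
Lemma sink_path_head_inj x y :
  sink G x -> sink G y -> path_head x = path_head y -> x = y.
Proof.
move=> sx sy E.
have [i Ex] := forward_path_head x; have [j Ey] := forward_path_head y.
rewrite -E in Ey; move: (path_head x) Ex Ey => h Ex Ey {E}.
wlog le_ij : x y i j sx sy Ex Ey / i <= j.
  move=> W; case/orP: (leq_total i j) => H; first exact: (W x y i j).
  by symmetry; exact: (W y x j i).
by rewrite Ey -(subnK le_ij) iterD -Ex forward_sink.
Qed.

Lemma source_closing x : source G (closing x) = sink G x.
Proof.
case: (boolP (sink G x)) => sx.
  by rewrite closing_sink // source_path_head_sink.
by rewrite /source; have /eqP := closingE sx; rewrite nxtE -prvE => /eqP ->.
Qed.

(** Sinks go to sources and other vertices do not, so only vertices of the same kind could collide.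
    Two sinks are separated by their heads, two other vertices by the uniqueness of predecessors. *)
Lemma closing_inj : injective closing.
Proof.
move=> x y E.
have sxy : sink G x = sink G y by rewrite -!source_closing E.
case: (boolP (sink G x)) => sx; have sy := sx; rewrite sxy in sy.
  by apply: sink_path_head_inj; rewrite // -!closing_sink.
have /eqP := closingE sx; have /eqP := closingE sy; rewrite !nxtE -!prvE E => /eqP ->.
by case/eqP.
Qed.

(** Backward steps lead from every vertex of the orbit to [closing x], so all sinks of the orbit
    share this head. *)
Lemma sink_orbit_uniq x y :
  sink G x -> sink G y -> fconnect closing x y -> x = y.
Proof.
move=> sx sy Cxy; set h := closing x.
have sh : source G h by rewrite source_closing.
have back k : exists i, iter i backward (iter k closing h) = h.
  elim: k => [|k [i IH]]; first by exists 0.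
  rewrite iterS; set w := iter k closing h in IH *.
  case: (boolP (sink G w)) => sw; last first.
    exists i.+1; rewrite iterSr -[RHS]IH; congr (iter i backward _).
    by rewrite /backward; have /eqP := closingE sw; rewrite nxtE -prvE => /eqP ->.
  (* The [i] backward steps from [w] to [h] commute with the [n] steps of [path_head]; since [h] and
     [path_head w] are both sources, they are equal. *)
  rewrite closing_sink //; exists 0 => /=.
  have Hw := source_path_head_sink sw.
  rewrite -(backward_source i Hw) /path_head -iterD addnC iterD IH.
  by rewrite backward_source.
have /iter_findex Ey : fconnect closing h y by rewrite -same_fconnect1 //; exact: closing_inj.
have [i] := back (findex closing h y); rewrite Ey => Ei.
apply: closing_inj; rewrite -/h closing_sink //.
have Hy := source_path_head_sink sy.
by rewrite -(backward_source i Hy) /path_head -iterD addnC iterD Ei backward_source.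
Qed.

Lemma adj_sym : symmetric (adj G).
Proof. by move=> x y; rewrite /adj orbC. Qed.

Lemma connect_adj_sym : connect_sym (adj G).
Proof. exact/sym_connect_sym/adj_sym. Qed.

(** Edges are steps of [closing], and the additional step from a sink to its head is a chain of
    edges traversed backward. *)
Lemma connect_adjE : connect (adj G) =2 fconnect closing.
Proof.
have edge x y : (x, y) \in G -> closing x = y.
  by rewrite -nxtE /closing => /eqP ->.
have back x : connect (adj G) x (backward x).
  case: (boolP (source G x)) => [sx | /backwardK/eqP].
    by rewrite -[backward x]/(iter 1 backward x) backward_source.
  by rewrite nxtE => E; apply: connect1; rewrite /adj E orbT.
move=> x y; apply/idP/idP; apply: connect_sub => {x y} x y.
  case/orP=> /edge <-; first exact: fconnect1.
  by rewrite fconnect_sym ?fconnect1 //; exact: closing_inj.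
move=> /eqP <-; case: (boolP (sink G x)) => sx; last first.
  by have /eqP := closingE sx; rewrite nxtE => E; apply: connect1; rewrite /adj E.
rewrite closing_sink // /path_head.
suff H k : connect (adj G) x (iter k backward x) by exact: H.
elim: k => //= k IH.
exact: connect_trans IH (back _).
Qed.

Lemma sink_connect_uniq x y : sink G x -> sink G y -> connect (adj G) x y -> x = y.
Proof. by rewrite connect_adjE; exact: sink_orbit_uniq. Qed.

Lemma source_connect_sink b : source G b -> exists2 a, sink G a & connect (adj G) a b.
Proof.
have fK := f_finv closing_inj.
rewrite -(fK b) source_closing => Hs; exists (finv closing b) => //.
by rewrite connect_adjE fconnect1.
Qed.

(** The permutation [closing] pulls the set of sources back to the set of sinks. *)
Lemma card_source_sink : #|source G| = #|sink G|.
Proof.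
rewrite -!sum1_card [LHS](reindex_inj closing_inj).
by apply: eq_bigl => x; exact: source_closing.
Qed.


(** * Components that are paths or cycles *)

Definition component (x : 'I_n) : {set 'I_n} := [set y | connect (adj G) x y].

Lemma component_self x : x \in component x.
Proof. by rewrite inE connect0. Qed.

Lemma component_eq x y : (component x == component y) = connect (adj G) x y.
Proof.
apply/eqP/idP => [E | Cxy]; first by have := component_self y; rewrite -E inE.
by apply/setP=> z; rewrite !inE (same_connect connect_adj_sym Cxy).
Qed.

Lemma component_orbit x : component x =i orbit closing x.
Proof. by move=> y; rewrite inE connect_adjE fconnect_orbit. Qed.

Lemma card_component x : #|component x| = order closing x.
Proof.
by rewrite -size_orbit -(card_uniqP (orbit_uniq _ _)); apply: eq_card; exact: component_orbit.
Qed.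

Lemma eq_iter_closing x i j : i < order closing x -> j < order closing x ->
  (iter i closing x == iter j closing x) = (i == j).
Proof.
move=> Hi Hj; apply/eqP/eqP => [E | -> //].
by rewrite -(findex_iter Hi) E findex_iter.
Qed.

Lemma orbit_component_tuple x :
  exists s : #|component x|.-tuple 'I_n, [set y in s] = component x /\
    forall a : 'I_#|component x|, tnth s a = iter a closing x.
Proof.
have Hs : size (orbit closing x) == #|component x| by rewrite size_orbit card_component.
exists (Tuple Hs); split; first by apply/setP=> y; rewrite inE component_orbit.
move=> a; rewrite (tnth_nth x) nth_traject //.
by rewrite -card_component.
Qed.

Lemma component_edge x y z : y \in component x -> (y, z) \in G -> z \in component x.
Proof.
rewrite !inE => Cxy Hyz; apply: connect_trans Cxy (connect1 _).
by rewrite /adj Hyz.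
Qed.

Lemma mem_edge_closing x i j : i.+1 < order closing x -> j < order closing x ->
  ~~ sink G (iter i closing x) ->
  ((iter i closing x, iter j closing x) \in G) = (j == i.+1).
Proof.
by move=> Hi Hj Ns; rewrite -nxtE closingE // -iterS (inj_eq Some_inj) eq_iter_closing // eq_sym.
Qed.

Lemma sink_no_edge x y : sink G x -> (x, y) \notin G.
Proof. by rewrite -nxtE => /eqP ->. Qed.

(** The last vertex of a path is a sink, since its successor would lie in the same component at a
    later position. Conversely, the orbit listed from the head [closing z] ends at the sink [z]. *)
Lemma is_dipath_component x :
  is_dipath G (component x) = [exists z in component x, sink G z].
Proof.
apply/existsP/exists_inP => [[s /andP[/eqP /setP Es /forallP H]] | [z Cz sz]].
  have Hm_s y : (y \in component x) = (y \in s) by rewrite -Es inE.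
  have m_gt0 : 0 < #|component x| by apply/card_gt0P; exists x; exact: component_self.
  have Hm : #|component x|.-1 < #|component x| by rewrite prednK.
  pose a := Ordinal Hm; have Ca : tnth s a \in component x by rewrite Hm_s mem_tnth.
  exists (tnth s a); first by [].
  rewrite /sink; case E: (nxt G _) => [y|] //; move/eqP: E; rewrite nxtE => E.
  have := component_edge Ca E; rewrite Hm_s => /tnthP[b Eb].
  have /forallP /(_ b) := H a; rewrite -Eb E /= prednK // => /eqP /esym /eqP Hb.
  by have := ltn_ord b; rewrite Hb ltnn.
have fz : component (closing z) = component x.
  apply/eqP; rewrite component_eq connect_adj_sym.
  apply: connect_trans (_ : connect _ x z) _; first by rewrite inE in Cz.
  by rewrite connect_adjE fconnect1.
rewrite -fz; set h := closing z.
have [s [Es Hs]] := orbit_component_tuple h.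
exists s; rewrite Es eqxx; apply/forallP=> a; apply/forallP=> b; rewrite !Hs.
have Ha : a < order closing h by rewrite -card_component.
have Hb : b < order closing h by rewrite -card_component.
move: Ha; rewrite leq_eqVlt => /orP[/eqP Ha | Ha].
  have -> : iter a closing h = z.
    by apply: closing_inj; rewrite -iterS Ha iter_order //; exact: closing_inj.
  by rewrite (negbTE (sink_no_edge _ sz)) Ha ltn_eqF.
(* A sink before the last position would be [z], whose image is [h], so the orbit would return to
   [h] too early. *)
rewrite mem_edge_closing //; apply/negP=> sa.
have Ez : z = iter a closing h.
  apply: sink_connect_uniq => //.
  by rewrite connect_adjE -iterSr fconnect_iter.
have : iter a.+1 closing h == iter 0 closing h by rewrite iterS -Ez.
by rewrite eq_iter_closing // (leq_ltn_trans _ Ha).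
Qed.

(** Without a sink, [closing] follows edges all the way around the orbit; in a cycle every position
    has a next one modulo the length. *)
Lemma is_dicycle_component x :
  is_dicycle G (component x) = [forall z in component x, ~~ sink G z].
Proof.
apply/existsP/forall_inP => [[s /andP[/eqP /setP Es /forallP H]] z | Ns].
  rewrite -Es inE => /tnthP[a ->]; apply/negP => sa.
  have m_gt0 : 0 < #|component x| by rewrite (leq_ltn_trans _ (ltn_ord a)).
  have /forallP /(_ (Ordinal (ltn_pmod a.+1 m_gt0))) := H a.
  by rewrite (negbTE (sink_no_edge _ sa)) eqxx.
have [s [Es Hs]] := orbit_component_tuple x.
exists s; rewrite Es eqxx; apply/forallP=> a; apply/forallP=> b; rewrite !Hs.
have Nsa : ~~ sink G (iter a closing x) by rewrite Ns // inE connect_adjE fconnect_iter.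
have Ha : a < order closing x by rewrite -card_component.
have Hb : b < order closing x by rewrite -card_component.
move: (nat_of_ord a) (nat_of_ord b) Nsa Ha Hb => {s Es Hs} {}a {}b Nsa Ha Hb.
rewrite card_component; move: Ha; rewrite leq_eqVlt => /orP[/eqP Ha | Ha]; last first.
  by rewrite mem_edge_closing // modn_small.
rewrite Ha modnn -nxtE closingE // -iterS Ha iter_order; last exact: closing_inj.
by rewrite (inj_eq Some_inj) -{1}[x]/(iter 0 closing x) eq_iter_closing // [0 == b]eq_sym.
Qed.

(** Sending a sink to its component is a bijection onto the path components. *)
Lemma npathsE : npaths G = #|sink G|.
Proof.
rewrite /npaths -(card_in_imset (f := component) (D := sink G)); last first.
  by move=> x y sx sy /eqP; rewrite component_eq; exact: sink_connect_uniq.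
apply: eq_card => C; rewrite inE; apply/andP/imsetP => [[/imsetP[x _ ->]] | [x sx ->]].
  rewrite -/(component x) is_dipath_component => /exists_inP[z Cz sz].
  by exists z; last by apply/eqP; rewrite component_eq; rewrite inE in Cz.
split; first by apply/imsetP; exists x.
by rewrite is_dipath_component; apply/exists_inP; exists x; first exact: component_self.
Qed.

(* The cycles are counted by their largest vertices; a component is a cycle iff
   it has no sink. *)
Definition cyclic_rep (G : digraph n) : pred 'I_n := fun x =>
  [forall y, connect (adj G) x y ==> (y <= x) && ~~ sink G y].

Lemma cycE : cyc G = #|cyclic_rep G|.
Proof.
rewrite /cyc -(card_in_imset (f := component) (D := cyclic_rep G)); last first.
  move=> x y /forallP Hx /forallP Hy /eqP; rewrite component_eq => Cxy.
  have := Hx y; rewrite Cxy => /andP[le1 _].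
  have := Hy x; rewrite connect_adj_sym Cxy => /andP[le2 _].
  by apply/val_inj/eqP; rewrite /= eqn_leq le1 le2.
apply: eq_card => C; rewrite inE; apply/andP/imsetP => [[/imsetP[x _ ->]] | [x Hx ->]].
  rewrite -/(component x) is_dicycle_component => /forall_inP Ns.
  have [z /= Cz Hz] :=
    @arg_maxnP _ x [in component x] (fun y : 'I_n => val y) (component_self x).
  rewrite inE in Cz; exists z; last by apply/eqP; rewrite component_eq.
  apply/forallP=> y; apply/implyP=> Czy.
  have Cy : y \in component x by rewrite inE (connect_trans Cz).
  by rewrite Ns // andbT; exact: Hz.
split; first by apply/imsetP; exists x.
rewrite is_dicycle_component; apply/forall_inP=> y; rewrite inE => Cxy.
by have /forallP/(_ y) := Hx; rewrite Cxy => /andP[].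
Qed.

End Structure.

(** * Insertion of the largest vertex *)

Lemma sourceP (n : nat) (G : digraph n) (b : 'I_n) :
  reflect (forall i, (i, b) \notin G) (source G b).
Proof.
rewrite /source /prv; case: pickP => [i Hi | H]; constructor; last by move=> i; rewrite H.
by move/(_ i); rewrite Hi.
Qed.

Lemma sinkP (n : nat) (G : digraph n) (a : 'I_n) :
  reflect (forall i, (a, i) \notin G) (sink G a).
Proof.
rewrite /sink /nxt; case: pickP => [i Hi | H]; constructor; last by move=> i; rewrite H.
by move/(_ i); rewrite Hi.
Qed.

Definition widen (n : nat) : 'I_n -> 'I_n.+1 := widen_ord (leqnSn n).

Lemma widen_inj n : injective (@widen n).
Proof. by move=> i j /(congr1 val) /= H; apply: val_inj. Qed.

Lemma widen_lift n (i : 'I_n) : widen i = lift ord_max i.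
Proof. exact/val_inj/esym/lift_max. Qed.

Lemma widen_neq_max n (i : 'I_n) : (widen i == ord_max) = false.
Proof. by rewrite widen_lift eq_sym; apply/negbTE/neq_lift. Qed.

Lemma widen_ind n (P : 'I_n.+1 -> Prop) :
  (forall i, P (widen i)) -> P ord_max -> forall i, P i.
Proof.
move=> Hw Hm i; case: (unliftP ord_max i) => [j ->|-> //].
by rewrite -widen_lift.
Qed.

Lemma gt_max_widen n (i : 'I_n) : (@ord_max n < widen i) = false.
Proof. by rewrite ltnNge ltnW //=. Qed.

Lemma card_widen n (P : pred 'I_n.+1) :
  #|[set i | P i]| = #|[set i | P (widen i)]| + P ord_max.
Proof.
by rewrite -!sum1dep_card big_mkcond big_ord_recr /= -big_mkcond /=; case: (P ord_max).
Qed.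

(** Both indices of a nonzero term lie below [k], so neither can be the largest vertex. *)
Lemma sum_widen2 n (F : 'I_n.+1 -> 'I_n.+1 -> bool) (k : 'I_n.+1) :
  (forall i j, F i j -> i < j < k) ->
  \sum_(i < n.+1) \sum_(j < n.+1) F i j = \sum_(i < n) \sum_(j < n) F (widen i) (widen j).
Proof.
move=> HF; have Hm (j : 'I_n.+1) : (@ord_max n < j) = false by rewrite ltnNge -ltnS ltn_ord.
have F0 (i j : 'I_n.+1) : ~~ (i < j < k) -> F i j = false.
  by move=> H; apply/negbTE/negP=> /HF; apply/negP.
rewrite big_ord_recr /= [X in _ + X]big1 ?addn0 => [|j _].
  apply: eq_bigr => i _; rewrite big_ord_recr /= [X in _ + X](_ : _ = 0) ?addn0 //.
  by rewrite F0 // Hm andbF.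
by rewrite F0 // Hm.
Qed.

(* [insert_max G ob oa] has the new edges [oa -> ord_max -> ob], where [None]
   stands for the absence of the edge. *)
Definition insert_max (n : nat) (G : digraph n) (ob oa : option 'I_n) : digraph n.+1 :=
  [set e | match unlift ord_max e.1, unlift ord_max e.2 with
           | Some i, Some j => (i, j) \in G
           | Some i, None => oa == Some i
           | None, Some j => ob == Some j
           | None, None => false
           end].

Definition restrict (n : nat) (G : digraph n.+1) : digraph n :=
  [set e | (widen e.1, widen e.2) \in G].

Section InsertMem.
Variables (n : nat) (G : digraph n) (ob oa : option 'I_n).
Local Notation G' := (insert_max G ob oa).

Lemma mem_insert_max i j :
  [/\ ((widen i, widen j) \in G') = ((i, j) \in G),
      ((widen i, ord_max) \in G') = (oa == Some i),
      ((ord_max, widen j) \in G') = (ob == Some j)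
    & ((ord_max, ord_max) \in G') = false].
Proof. by rewrite !inE /= !widen_lift !liftK unlift_none. Qed.

Lemma insert_max_ww i j : ((widen i, widen j) \in G') = ((i, j) \in G).
Proof. by case: (mem_insert_max i j). Qed.
Lemma insert_max_wm i : ((widen i, ord_max) \in G') = (oa == Some i).
Proof. by case: (mem_insert_max i i). Qed.
Lemma insert_max_mw j : ((ord_max, widen j) \in G') = (ob == Some j).
Proof. by case: (mem_insert_max j j). Qed.
Lemma insert_max_mm : ((ord_max, ord_max) \in G') = false.
Proof. by rewrite !inE unlift_none. Qed.

Definition insert_maxE := (insert_max_ww, insert_max_wm, insert_max_mw, insert_max_mm).

Lemma restrict_insert_max : restrict G' = G.
Proof. by apply/setP=> -[i j]; rewrite inE insert_max_ww. Qed.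

Lemma pick_insert_max_ob : [pick j | (ord_max, widen j) \in G'] = ob.
Proof.
case: pickP => [j | H]; first by rewrite insert_max_mw => /eqP ->.
by case E: ob => [b|] //; have := H b; rewrite insert_max_mw E eqxx.
Qed.

Lemma pick_insert_max_oa : [pick i | (widen i, ord_max) \in G'] = oa.
Proof.
case: pickP => [j | H]; first by rewrite insert_max_wm => /eqP ->.
by case E: oa => [b|] //; have := H b; rewrite insert_max_wm E eqxx.
Qed.

Lemma laguerre_insert_max :
  laguerre G' = [&& laguerre G, oapp (source G) true ob & oapp (sink G) true oa].
Proof.
apply/laguerreP/and3P => [[H1 H2] | [/laguerreP[H1 H2] Hb Ha]].
- split.
  + apply/laguerreP; split=> i j k Hj Hk; apply: widen_inj.
      by apply: (H1 (widen i)); rewrite insert_max_ww.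
    by apply: (H2 (widen i)); rewrite insert_max_ww.
  + case E: ob => [b|] //=; apply/sourceP=> i; apply/negP=> Hi.
    have := H2 (widen b) (widen i) ord_max; rewrite !insert_maxE Hi E eqxx.
    by move/(_ isT isT)/eqP; rewrite widen_neq_max.
  + case E: oa => [b|] //=; apply/sinkP=> i; apply/negP=> Hi.
    have := H1 (widen b) (widen i) ord_max; rewrite !insert_maxE Hi E eqxx.
    by move/(_ isT isT)/eqP; rewrite widen_neq_max.
- have Nb i j : (i, j) \in G -> ob == Some j -> False.
    by move=> Hij /eqP E; move: Hb; rewrite E /= => /sourceP /(_ i); rewrite Hij.
  have Na i j : (i, j) \in G -> oa == Some i -> False.
    by move=> Hij /eqP E; move: Ha; rewrite E /= => /sinkP /(_ j); rewrite Hij.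
  split; elim/widen_ind => [i|]; elim/widen_ind => [j|]; elim/widen_ind => [k|];
    rewrite !insert_maxE //.
  + by move=> Hj Hk; rewrite (H1 i j k).
  + by move=> Hj /(Na _ _ Hj).
  + by move=> Hj Hk; case: (Na _ _ Hk Hj).
  + by move=> /eqP -> /eqP[->].
  + by move=> Hj Hk; rewrite (H2 i j k).
  + by move=> Hj /(Nb _ _ Hj).
  + by move=> Hj Hk; case: (Nb _ _ Hk Hj).
  + by move=> /eqP -> /eqP[->].
Qed.

End InsertMem.

Lemma insert_max_restrict (n : nat) (G : digraph n.+1) :
  laguerre G -> (ord_max, ord_max) \notin G ->
  insert_max (restrict G) [pick j | (ord_max, widen j) \in G]
    [pick i | (widen i, ord_max) \in G] = G.
Proof.
move=> /laguerreP[H1 H2] Nmm; apply/setP=> -[i j]; move: i j.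
elim/widen_ind => [i|]; elim/widen_ind => [j|]; rewrite insert_maxE.
- by rewrite inE.
- case: pickP => [k Hk | ->]; last by [].
  by apply/eqP/idP => [[<-] // | Hi]; rewrite (widen_inj (H2 _ _ _ Hk Hi)).
- case: pickP => [k Hk | ->]; last by [].
  by apply/eqP/idP => [[<-] // | Hi]; rewrite (widen_inj (H1 _ _ _ Hk Hi)).
- by rewrite (negbTE Nmm).
Qed.

(** Neighbour of an old vertex after the insertion, [o] being the former one. The flag [c] signals a
    new edge to the largest vertex; it is raised only where [o] was infinity. *)
Definition extend (n : nat) (c : bool) (o : option 'I_n) : option 'I_n.+1 :=
  if c then Some ord_max else omap (@widen n) o.

Section Extend.
Variables (n : nat) (c : bool) (o : option 'I_n).
Hypothesis co : c ==> (o == None).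

Lemma extend_eq v : (extend c o == Some (widen v)) = (o == Some v).
Proof.
rewrite /extend; case: c co => [/= /eqP -> | _].
  by rewrite (inj_eq Some_inj) eq_sym widen_neq_max.
by case: o => //= i; rewrite !(inj_eq Some_inj) (inj_eq (@widen_inj n)).
Qed.

Lemma extend_eq_max : (extend c o == Some ord_max) = c.
Proof.
rewrite /extend; case: c => [|]; first by rewrite eqxx.
by case: o => //= i; rewrite (inj_eq Some_inj) widen_neq_max.
Qed.

Lemma extend_eq_None : (extend c o == None) = ~~ c && (o == None).
Proof. by rewrite /extend; case: c => //; case: o. Qed.

(** Infinity and the new largest vertex both exceed all old vertices, so exchanging them affects no
    comparison with an old vertex. This is why old vertices keep their kinds and statistics. *)
Lemma ltv_extend_l v : ltv (extend c o) (Some (widen v)) = ltv o (Some v).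
Proof.
rewrite /extend; case: c co => [/= /eqP -> | _] /=; last by case: o.
by rewrite ltnNge ltnW.
Qed.

Lemma ltv_extend_r v : ltv (Some (widen v)) (extend c o) = ltv (Some v) o.
Proof.
by rewrite /extend; case: c co => [/= /eqP -> | _] /=; [exact: ltn_ord | case: o].
Qed.

Lemma ltv_extend_max_l : ltv (extend c o) (Some ord_max) = ~~ c && (o != None).
Proof. by rewrite /extend; case: c => /=; [rewrite ltnn | case: o => //= i; exact: ltn_ord]. Qed.

Lemma ltv_extend_max_r : ltv (Some ord_max) (extend c o) = ~~ c && (o == None).
Proof.
rewrite /extend; case: c => /=; first by rewrite ltnn.
by case: o => //= i; rewrite ltnNge ltnW.
Qed.

End Extend.

(** The entry [l] of a triple is determined by [j], so the triples reduce to pairs. *)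
Lemma lcrossE (n : nat) (G : digraph n) k : lcross G k =
  \sum_(i < n) \sum_(j < n)
    [&& i < j, j < k, prv G i == Some k & ltv (Some k) (prv G j)].
Proof.
rewrite pair_big /= -big_mkcond sum1dep_card /lcross.
rewrite -(card_imset _ (f := fun ij : 'I_n * 'I_n => (ij, prv G ij.2))); last by move=> x y [].
apply: eq_card => -[[i j] l]; rewrite inE; apply/idP/imsetP.
  case/and5P=> ij jk kl ik /eqP jl; exists (i, j); last by rewrite jl.
  by rewrite inE /= ij jk ik jl.
by case=> -[i' j'] /[!inE] /= /and4P[ij jk ik kj] [-> -> ->]; rewrite ij jk kj ik eqxx.
Qed.

Lemma lnestE (n : nat) (G : digraph n) k : lnest G k =
  \sum_(i < n) \sum_(j < n)
    [&& i < j, j < k, prv G j == Some k & ltv (Some k) (prv G i)].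
Proof.
rewrite pair_big /= -big_mkcond sum1dep_card /lnest.
rewrite -(card_imset _ (f := fun ij : 'I_n * 'I_n => (ij, prv G ij.1))); last by move=> x y [].
apply: eq_card => -[[i j] l]; rewrite inE; apply/idP/imsetP.
  case/and5P=> ij jk kl jk' /eqP il; exists (i, j); last by rewrite il.
  by rewrite inE /= ij jk jk' il.
by case=> -[i' j'] /[!inE] /= /and4P[ij jk ik kj] [-> -> ->]; rewrite ij jk kj ik eqxx.
Qed.

(** * Effect of an insertion on the statistics *)

Section InsertStats.
Variables (n : nat) (G : digraph n) (ob oa : option 'I_n).
Hypothesis lagG : laguerre G.
Hypothesis Hb : oapp (source G) true ob.
Hypothesis Ha : oapp (sink G) true oa.
Local Notation G' := (insert_max G ob oa).

Lemma laguerre_insert : laguerre G'.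
Proof. by rewrite laguerre_insert_max lagG Hb. Qed.

Lemma ob_prv j : (ob == Some j) ==> (prv G j == None).
Proof. by apply/implyP=> /eqP E; move: Hb; rewrite E. Qed.

Lemma oa_nxt j : (oa == Some j) ==> (nxt G j == None).
Proof. by apply/implyP=> /eqP E; move: Ha; rewrite E. Qed.

Lemma prv_insert_w j : prv G' (widen j) = extend (ob == Some j) (prv G j).
Proof.
have L := laguerre_insert; rewrite /extend; case: ifP => E; first by apply/eqP; rewrite prvE // insert_maxE.
case Ep: (prv G j) => [i|] /=; apply/eqP.
  by rewrite prvE // insert_maxE -prvE // Ep.
apply/sourceP; elim/widen_ind=> [i|]; rewrite insert_maxE ?E //.
by rewrite -prvE // Ep.
Qed.

Lemma prv_insert_m : prv G' ord_max = omap (@widen n) oa.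
Proof.
move: laguerre_insert; case: oa => [a|] L /=; apply/eqP; first by rewrite prvE // insert_maxE eqxx.
by apply/sourceP; elim/widen_ind=> [i|]; rewrite insert_maxE.
Qed.

Lemma nxt_insert_w j : nxt G' (widen j) = extend (oa == Some j) (nxt G j).
Proof.
have L := laguerre_insert; rewrite /extend; case: ifP => E; first by apply/eqP; rewrite nxtE // insert_maxE.
case Ep: (nxt G j) => [i|] /=; apply/eqP.
  by rewrite nxtE // insert_maxE -nxtE // Ep.
apply/sinkP; elim/widen_ind=> [i|]; rewrite insert_maxE ?E //.
by rewrite -nxtE // Ep.
Qed.

Lemma nxt_insert_m : nxt G' ord_max = omap (@widen n) ob.
Proof.
move: laguerre_insert; case: ob => [a|] L /=; apply/eqP; first by rewrite nxtE // insert_maxE eqxx.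
by apply/sinkP; elim/widen_ind=> [i|]; rewrite insert_maxE.
Qed.

#[local] Hint Resolve ob_prv oa_nxt : core.

Lemma peak_insert_w i : peak G' (widen i) = peak G i.
Proof. by rewrite /peak prv_insert_w nxt_insert_w !ltv_extend_l //. Qed.

Lemma valley_insert_w i : valley G' (widen i) = valley G i.
Proof. by rewrite /valley prv_insert_w nxt_insert_w !ltv_extend_r //. Qed.

Lemma peak_insert_m : peak G' ord_max = (oa != None) && (ob != None).
Proof.
rewrite /peak prv_insert_m nxt_insert_m.
by rewrite -![omap _ _]/(extend false _) !ltv_extend_max_l.
Qed.

Lemma valley_insert_m : valley G' ord_max = (oa == None) && (ob == None).
Proof.
rewrite /valley prv_insert_m nxt_insert_m.
by rewrite -![omap _ _]/(extend false _) !ltv_extend_max_r.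
Qed.

(** Old vertices keep their kinds. The new vertex is above both neighbours when both new edges are
    present and below both when neither is; a single edge makes it a double ascent or a double
    descent. *)
Lemma alternating_insert : alternating G' = alternating G && ((oa == None) == (ob == None)).
Proof.
have Hm : [&& ~~ double_ascent G' ord_max, ~~ double_descent G' ord_max
             & ~~ fixed_point G' ord_max] = ((oa == None) == (ob == None)).
  rewrite /double_ascent /double_descent /fixed_point prv_insert_m nxt_insert_m.
  rewrite -![omap _ _]/(extend false _) !ltv_extend_max_r !ltv_extend_max_l !extend_eq_max /=.
  by case: (oa); case: (ob).
have Hw i : [&& ~~ double_ascent G' (widen i), ~~ double_descent G' (widen i)
             & ~~ fixed_point G' (widen i)] =
            [&& ~~ double_ascent G i, ~~ double_descent G i & ~~ fixed_point G i].
  rewrite /double_ascent /double_descent /fixed_point prv_insert_w nxt_insert_w.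
  by rewrite !ltv_extend_l ?ltv_extend_r ?extend_eq //.
apply/forallP/andP => [H | [/forallP H1 H2]].
  by rewrite -Hm; split; [apply/forallP=> i; rewrite -Hw; exact: H | exact: H].
by elim/widen_ind=> [i|]; [rewrite Hw | rewrite Hm].
Qed.

(** The vertex [oa] stops being a sink, and the new vertex is one iff [ob] is absent. Additions on
    both sides avoid truncated subtraction. *)
Lemma card_sink_insert :
  #|sink G'| + (oa != None) = #|sink G| + (ob == None).
Proof.
have -> : #|sink G'| = #|[set i | sink G' i]| by rewrite cardsE.
rewrite (card_widen (sink G')).
have -> : sink G' ord_max = (ob == None).
  by rewrite /sink nxt_insert_m; case: (ob).
have -> : [set i | sink G' (widen i)] = [set i | sink G i & oa != Some i].
  by apply/setP=> i; rewrite !inE /sink nxt_insert_w extend_eq_None // andbC.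
case E: oa => [a|] /=; last first.
  rewrite addn0; congr (_ + _); rewrite -[in RHS]cardsE; apply: eq_card => i.
  by rewrite !inE andbT.
rewrite addnAC; congr (_ + _); have sa : sink G a by move: Ha; rewrite E.
rewrite [RHS](cardD1 a) [a \in sink G]sa addnC; congr (_ + _); apply: eq_card => i.
by rewrite !inE (inj_eq Some_inj) eq_sym andbC.
Qed.

(* The letter of the predecessor word at [ord_max] is [oa], so the sink [oa]
   itself may become a record value. *)
Lemma record_value_insert_w v : nxt G v != None ->
  record_value G' (Some (widen v)) = record_value G (Some v).
Proof.
move=> Nv; apply/existsP/existsP.
  case; elim/widen_ind=> [i|] /andP[].
    rewrite eq_sym prv_insert_w extend_eq // => Ei /forallP H.
    exists i; rewrite eq_sym Ei; apply/forallP=> j; apply/implyP=> ji.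
    have := H (widen j); rewrite ji !prv_insert_w (eqP Ei) /=.
    have /eqP -> : extend (ob == Some i) (Some v) == Some (widen v).
      by rewrite -(eqP Ei) extend_eq // Ei.
    by rewrite ltv_extend_l.
  rewrite prv_insert_m; case E: oa => [a|] //=.
  rewrite (inj_eq Some_inj) (inj_eq (@widen_inj n)) => /eqP Ev.
  by move: Ha Nv; rewrite E /= /sink Ev => ->.
case=> i /andP[]; rewrite eq_sym => Ei /forallP H.
have Ei' : prv G' (widen i) == Some (widen v) by rewrite prv_insert_w extend_eq.
exists (widen i); rewrite eq_sym Ei' (eqP Ei'); apply/forallP.
elim/widen_ind=> [j|]; last by rewrite /= ltnNge ltnW.
apply/implyP=> ji; have := H j; rewrite ji prv_insert_w ltv_extend_l //.
by rewrite (eqP Ei).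
Qed.

Lemma peak_nxt i : peak G i -> nxt G i != None.
Proof. by rewrite /peak => /andP[_]; case: (nxt G i). Qed.

Lemma statA_insert (c : pred 'I_n.+1) : statA c G' =
  statA (c \o @widen n) G + [&& c ord_max, peak G' ord_max & record_value G' (Some ord_max)].
Proof.
rewrite /statA (card_widen (fun i => [&& c i, peak G' i & record_value G' (Some i)])).
congr (_ + _); apply: eq_card => i; rewrite !inE peak_insert_w /=.
by case: (boolP (peak G i)) => [/peak_nxt/record_value_insert_w -> |].
Qed.

Lemma statB_insert (c : pred 'I_n.+1) : statB c G' =
  statB (c \o @widen n) G + [&& c ord_max, peak G' ord_max & ~~ record_value G' (Some ord_max)].
Proof.
rewrite /statB (card_widen (fun i => [&& c i, peak G' i & ~~ record_value G' (Some i)])).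
congr (_ + _); apply: eq_card => i; rewrite !inE peak_insert_w /=.
by case: (boolP (peak G i)) => [/peak_nxt/record_value_insert_w -> |].
Qed.

Lemma statV_insert (c : pred 'I_n.+1) : statV c G' =
  statV (c \o @widen n) G + (c ord_max && valley G' ord_max).
Proof.
rewrite /statV (card_widen (fun i => c i && valley G' i)).
by congr (_ + _); apply: eq_card => i; rewrite !inE valley_insert_w.
Qed.

Lemma ulev_insert_w j : ulev G' (widen j) = ulev G j.
Proof.
rewrite /ulev nxt_insert_w ltv_extend_r //; case: ifP => // _.
rewrite (card_widen (fun i => (i < widen j) && ltv (Some (widen j)) (nxt G' i))).
rewrite gt_max_widen andFb addn0.
by apply: eq_card => i; rewrite !inE nxt_insert_w ltv_extend_r.
Qed.

Lemma lcross_insert_w k : lcross G' (widen k) = lcross G k.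
Proof.
rewrite !lcrossE (sum_widen2 (k := widen k)) => [|i j /and4P[-> ->] //].
apply: eq_bigr => i _; apply: eq_bigr => j _.
by rewrite !prv_insert_w extend_eq // ltv_extend_r.
Qed.

Lemma lnest_insert_w k : lnest G' (widen k) = lnest G k.
Proof.
rewrite !lnestE (sum_widen2 (k := widen k)) => [|i j /and4P[-> ->] //].
apply: eq_bigr => i _; apply: eq_bigr => j _.
by rewrite !prv_insert_w extend_eq // ltv_extend_r.
Qed.

Lemma statC_insert (c : pred 'I_n.+1) : statC c G' =
  statC (c \o @widen n) G + (c ord_max && peak G' ord_max) * lcross G' ord_max.
Proof.
rewrite /statC big_mkcond big_ord_recr /= [in RHS]big_mkcond; congr (_ + _).
  by apply: eq_bigr => i _; rewrite -/(widen i) peak_insert_w lcross_insert_w.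
by case: ifP; rewrite ?mul1n.
Qed.

Lemma statN_insert (c : pred 'I_n.+1) : statN c G' =
  statN (c \o @widen n) G + (c ord_max && peak G' ord_max) * lnest G' ord_max.
Proof.
rewrite /statN big_mkcond big_ord_recr /= [in RHS]big_mkcond; congr (_ + _).
  by apply: eq_bigr => i _; rewrite -/(widen i) peak_insert_w lnest_insert_w.
by case: ifP; rewrite ?mul1n.
Qed.

Lemma statL_insert (c : pred 'I_n.+1) : statL c G' =
  statL (c \o @widen n) G + (c ord_max && valley G' ord_max) * ulev G' ord_max.
Proof.
rewrite /statL big_mkcond big_ord_recr /= [in RHS]big_mkcond; congr (_ + _).
  by apply: eq_bigr => i _; rewrite -/(widen i) valley_insert_w ulev_insert_w.
by case: ifP; rewrite ?mul1n.
Qed.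

Lemma prv_insert_max_eq i : (prv G' (widen i) == Some ord_max) = (ob == Some i).
Proof. by rewrite prv_insert_w extend_eq_max. Qed.

Lemma ltv_max_prv_insert i :
  ltv (Some ord_max) (prv G' (widen i)) = (ob != Some i) && source G i.
Proof. by rewrite prv_insert_w ltv_extend_max_r. Qed.

(** The letter [ord_max] stands at position [b], and only infinity exceeds it, occurring among the
    old positions at the sources other than [b]. *)
Lemma lcross_insert_m b : ob = Some b ->
  lcross G' ord_max = #|[set j | source G j & b < j]|.
Proof.
move=> Eb; rewrite lcrossE (sum_widen2 (k := ord_max)) => [|i j /and4P[-> ->] //].
rewrite (big_only1 b) // => [|i /negbTE ib _]; last first.
  apply: big1 => j _; rewrite prv_insert_max_eq Eb (inj_eq Some_inj) eq_sym ib.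
  by rewrite !andbF.
rewrite (eq_bigr (fun j : 'I_n => nat_of_bool (source G j && (b < j)))) => [|j _].
  by rewrite -big_mkcond sum1dep_card.
rewrite prv_insert_max_eq ltv_max_prv_insert Eb eqxx (inj_eq Some_inj) /= ltn_ord.
by rewrite -val_eqE /=; case: ltngtP; rewrite ?andbF ?andbT.
Qed.

Lemma lnest_insert_m b : ob = Some b ->
  lnest G' ord_max = #|[set j | source G j & j < b]|.
Proof.
move=> Eb; rewrite lnestE (sum_widen2 (k := ord_max)) => [|i j /and4P[-> ->] //].
rewrite exchange_big (big_only1 b) // => [|i /negbTE ib _]; last first.
  apply: big1 => j _; rewrite prv_insert_max_eq Eb (inj_eq Some_inj) eq_sym ib.
  by rewrite !andbF.
rewrite (eq_bigr (fun j : 'I_n => nat_of_bool (source G j && (j < b)))) => [|j _].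
  by rewrite -big_mkcond sum1dep_card.
rewrite prv_insert_max_eq ltv_max_prv_insert Eb eqxx (inj_eq Some_inj) /= ltn_ord.
by rewrite -val_eqE /=; case: ltngtP; rewrite ?andbF ?andbT.
Qed.

(** The letter [ord_max] at position [b] is beaten only by infinity, which occurs to its left
    exactly at the sources below [b]. *)
Lemma record_value_insert_m b : ob = Some b ->
  record_value G' (Some ord_max) = (#|[set j | source G j & j < b]| == 0).
Proof.
move=> Eb; rewrite cards_eq0; apply/existsP/eqP => [[] | H0].
  elim/widen_ind => [i|] /andP[]; last first.
    rewrite prv_insert_m -[omap _ _]/(extend false _) eq_sym extend_eq_max //.
  rewrite eq_sym prv_insert_max_eq => /eqP E /forallP H.
  have {E} Ei : i = b by move: E; rewrite Eb => -[].
  rewrite {}Ei in H.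
  apply/setP=> j; rewrite !inE; apply/negbTE/negP=> /andP[sj jb].
  have := H (widen j); rewrite jb !prv_insert_w Eb eqxx ltv_extend_max_l.
  by rewrite (eqP sj) andbF.
exists (widen b); rewrite eq_sym prv_insert_max_eq {1}Eb eqxx; apply/forallP.
elim/widen_ind => [j|]; last by rewrite gt_max_widen.
apply/implyP=> jb; rewrite !prv_insert_w Eb eqxx ltv_extend_max_l (inj_eq Some_inj) -val_eqE.
rewrite gtn_eqF //=; have /setP/(_ j) := H0.
by rewrite !inE jb andbT => /negbT.
Qed.

(** The arcs passing over the new isolated vertex are those from the old sinks to infinity. *)
Lemma ulev_insert_m : oa = None -> ob = None -> ulev G' ord_max = #|sink G|.
Proof.
move=> Ea Eb; have Em : nxt G' ord_max = None by rewrite nxt_insert_m Eb.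
rewrite /ulev Em -[ltv (Some ord_max) None]/true.
rewrite (card_widen (fun i => (i < ord_max) && ltv (Some ord_max) (nxt G' i))) ltnn addn0.
rewrite -[RHS]cardsE; apply: eq_card => i.
have Hi : widen i < @ord_max n := ltn_ord i.
by rewrite !in_set nxt_insert_w ltv_extend_max_r Ea Hi.
Qed.

(** * Connectivity and cycles after an insertion *)

Lemma adj_insert_ww x y : adj G' (widen x) (widen y) = adj G x y.
Proof. by rewrite /adj !insert_maxE. Qed.

Lemma adj_insert_wm x : adj G' (widen x) ord_max = (oa == Some x) || (ob == Some x).
Proof. by rewrite /adj !insert_maxE. Qed.

Lemma connect_insert_w x y :
  connect (adj G) x y -> connect (adj G') (widen x) (widen y).
Proof.
case/connectP=> p; elim: p x => [|z p IH] x /=; first by move=> _ ->; exact: connect0.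
case/andP=> xz Hp Ey; apply: connect_trans (IH _ Hp Ey).
by apply: connect1; rewrite adj_insert_ww.
Qed.

(** Serves to bound components of the enlarged digraph from above: a closed set contains the
    component of each of its elements. *)
Lemma closed_insert (S : pred 'I_n.+1) :
  (forall x y, adj G x y -> S (widen x) -> S (widen y)) ->
  (forall x, (oa == Some x) || (ob == Some x) -> S (widen x) = S ord_max) ->
  closed (adj G') S.
Proof.
move=> H1 H2; apply: intro_closed; first exact: connect_adj_sym.
elim/widen_ind=> [x|]; elim/widen_ind=> [y|]; rewrite -?topredE /=.
- by rewrite adj_insert_ww; exact: H1.
- by rewrite adj_insert_wm => /H2 ->.
- by rewrite adj_sym adj_insert_wm => /H2 ->.
- by [].
Qed.

Lemma sink_insert_w x : sink G' (widen x) = (oa != Some x) && sink G x.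
Proof. by rewrite /sink nxt_insert_w extend_eq_None. Qed.

(** The new edges touch only ends of paths, so cycles are unaffected. A path either keeps its sink
    or is joined to [ord_max], which is larger than [x]; in both cases [x] represents no cycle. *)
Lemma cyclic_rep_insert_w x : cyclic_rep G' (widen x) = cyclic_rep G x.
Proof.
apply/forallP/forallP => H.
  move=> y; apply/implyP=> xy; have xy' := connect_insert_w xy.
  have := H (widen y); rewrite xy' sink_insert_w negb_and negbK => /andP[-> /=].
  case/orP=> // Ea; have := H ord_max.
  rewrite (connect_trans xy' (connect1 _)) ?adj_insert_wm ?Ea //=.
  by rewrite leqNgt ltn_ord.
have Na y : connect (adj G) x y -> ~~ sink G y.
  by move=> xy; have := H y; rewrite xy => /andP[].
have Nab y : (oa == Some y) || (ob == Some y) -> connect (adj G) x y = false.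
  case/orP=> /eqP E; apply/negP=> xy.
    by move: Ha; rewrite E /= (negbTE (Na _ xy)).
  have [a sa ab] : exists2 a, sink G a & connect (adj G) a y.
    by apply: source_connect_sink => //; move: Hb; rewrite E.
  by have := Na a; rewrite sa connect_adj_sym (connect_trans ab) 1?connect_adj_sym // => /(_ isT).
(* The component of [x] in [G], without the new vertex. *)
pose S : pred 'I_n.+1 := fun z => oapp (connect (adj G) x) false (unlift ord_max z).
have Sw y : S (widen y) = connect (adj G) x y by rewrite /S widen_lift liftK.
have Sm : S ord_max = false by rewrite /S unlift_none.
have CS : closed (adj G') S.
  apply: closed_insert => [y z yz | y Hy]; last by rewrite Sw Sm Nab.
  by rewrite !Sw => /connect_trans; apply; exact: connect1.
elim/widen_ind=> [y|]; apply/implyP => /(closed_connect CS); rewrite -!topredE /= Sw connect0.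
  rewrite Sw => /esym xy; have := H y; rewrite xy /= => /andP[-> Ny].
  by rewrite sink_insert_w negb_and Ny orbT.
by rewrite Sm.
Qed.

Lemma cyc_insert : cyc G' = cyc G + cyclic_rep G' ord_max.
Proof.
rewrite !cycE ?laguerre_insert // -cardsE (card_widen (cyclic_rep G')) -[in RHS]cardsE.
by congr (_ + _); apply: eq_card => x; rewrite !inE; exact: cyclic_rep_insert_w.
Qed.

Lemma cyclic_rep_insert_m_isolated : ob = None -> cyclic_rep G' ord_max = false.
Proof.
move=> E; apply/negP=> /forallP/(_ ord_max); rewrite connect0 /= => /andP[_].
by rewrite /sink nxt_insert_m E.
Qed.

Lemma cyclic_rep_insert_m a b : oa = Some a -> ob = Some b ->
  cyclic_rep G' ord_max = connect (adj G) a b.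
Proof.
move=> Ea Eb; have sa : sink G a by move: Ha; rewrite Ea.
have sb : source G b by move: Hb; rewrite Eb.
apply/forallP/idP => [H | ab].
  (* The path that starts at [b] ends at [a']; if [a'] differed from [a], it would remain a sink in
     the component of the new vertex. *)
  have [a' sa' ab] := source_connect_sink lagG sb.
  have Cma : connect (adj G') ord_max (widen a').
    rewrite connect_adj_sym; apply: connect_trans (connect_insert_w ab) (connect1 _).
    by rewrite adj_insert_wm Eb eqxx orbT.
  have := H (widen a'); rewrite Cma sink_insert_w sa' andbT negbK => /andP[_].
  by rewrite Ea => /eqP[->].
(* The component of [a] in [G], together with the new vertex. *)
pose S : pred 'I_n.+1 := fun z => oapp (connect (adj G) a) true (unlift ord_max z).
have Sw y : S (widen y) = connect (adj G) a y by rewrite /S widen_lift liftK.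
have Sm : S ord_max by rewrite /S unlift_none.
have CS : closed (adj G') S.
  apply: closed_insert => [y z yz | y]; last first.
    by rewrite Sw Sm Ea Eb => /orP[] /eqP[<-]; rewrite ?connect0.
  by rewrite !Sw => /connect_trans; apply; exact: connect1.
elim/widen_ind=> [y|]; apply/implyP => /(closed_connect CS); rewrite -!topredE /= Sm.
  rewrite Sw => /esym ay; rewrite ltnW //= sink_insert_w negb_and negbK.
  case: (boolP (sink G y)) => [sy | _]; last by rewrite orbT.
  by rewrite -(sink_connect_uniq lagG sa sy ay) Ea eqxx.
by rewrite leqnn /sink nxt_insert_m Eb.
Qed.

End InsertStats.

(** * Insertion within the classes [LDalt] *)

Lemma insert_isolated_LDalt (n k : nat) (G : digraph n) :
  (insert_max G None None \in LDalt n.+1 k) = (0 < k) && (G \in LDalt n k.-1).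
Proof.
rewrite !inE laguerre_insert_max /= !andbT; case: (boolP (laguerre G)) => lagG /=;
  last by rewrite andbF.
rewrite alternating_insert // eqxx andbT; case: (alternating G); last by rewrite andbF.
have := @card_sink_insert _ G None None lagG isT isT; rewrite addn0 addn1 => E.
rewrite !npathsE ?laguerre_insert_max ?lagG // E.
by case: k.
Qed.

Lemma insert_peak_LDalt (n k : nat) (G : digraph n) (a b : 'I_n) :
  (insert_max G (Some b) (Some a) \in LDalt n.+1 k) =
  [&& G \in LDalt n k.+1, source G b & sink G a].
Proof.
rewrite !inE laguerre_insert_max /=; case: (boolP (laguerre G)) => lagG //=.
case: (boolP (source G b)) => sb; last by rewrite andbF.
case: (boolP (sink G a)) => sa; last by rewrite !andbF.
rewrite alternating_insert // eqxx !andbT; case: (alternating G) => //=.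
have := @card_sink_insert _ G (Some b) (Some a) lagG sb sa; rewrite addn0 addn1 => E.
have lagG' : laguerre (insert_max G (Some b) (Some a)) by exact: laguerre_insert.
by rewrite (npathsE lagG') (npathsE lagG) -E.
Qed.

Lemma insert_half_LDalt (n k : nat) (G : digraph n) (ob oa : option 'I_n) :
  (ob == None) != (oa == None) -> (insert_max G ob oa \in LDalt n.+1 k) = false.
Proof.
move=> Hne; rewrite !inE laguerre_insert_max; apply/negP=> /and3P[/and3P[lagG Hb Ha]].
by rewrite alternating_insert // eq_sym (negbTE Hne) andbF.
Qed.

Lemma LDalt_insert_restrict (n k : nat) (G : digraph n.+1) : G \in LDalt n.+1 k ->
  insert_max (restrict G) [pick j | (ord_max, widen j) \in G]
    [pick i | (widen i, ord_max) \in G] = G.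
Proof.
rewrite inE => /and3P[lagG /forallP/(_ ord_max)/and3P[_ _ Nf] _].
apply: insert_max_restrict => //; apply/negP=> H; case/negP: Nf.
by rewrite /fixed_point prvE // nxtE // H.
Qed.

(** Expresses the crossings of the new peak through the rank of [b], so that its weight depends on
    this rank alone. *)
Lemma card_lt_gt (n : nat) (A : pred 'I_n) (b : 'I_n) : A b ->
  #|[set j | A j & b < j]| = (#|A|.-1 - #|[set j | A j & j < b]|)%N.
Proof.
move=> Ab; rewrite -[#|A|]cardsE (cardsD1 b [set x in A]).
have -> : b \in [set x in A] by rewrite inE.
rewrite -(cardsID [set j : 'I_n | j < b] (_ :\ b)) /=.
have -> : [set j | A j & j < b] = ([set x in A] :\ b) :&: [set j : 'I_n | j < b].
  apply/setP=> j; rewrite !inE -val_eqE.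
  by case: (ltngtP j b); rewrite ?andbF ?andbT.
rewrite /= add0n addKn; apply: eq_card => j; rewrite !inE -val_eqE.
by case: (ltngtP j b); rewrite ?andbF ?andbT.
Qed.

(** * Recurrences *)

Lemma lattice_path_rcons (N H : nat) (v : N.-tuple bool) (b : bool) :
  lattice_path H (rcons_tuple v b) =
  if b then (0 < H) && lattice_path H.-1 v else lattice_path H.+1 v.
Proof.
have Et t : t <= N -> take t (rcons v b) = take t v.
  by move=> Ht; rewrite -cats1 takel_cat // size_tuple.
have Ef : falls (rcons v b) = falls v + ~~ b.
  by rewrite /falls -cats1 count_cat /= addn0.
have Er : rises (rcons v b) = rises v + b.
  by rewrite /rises -cats1 count_cat /= addn0.
have Em : take N.+1 (rcons v b) = rcons v b by rewrite take_oversize // size_rcons size_tuple.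
have En : take N v = v by rewrite take_oversize // size_tuple.
rewrite /lattice_path /ht /= Em En Ef Er.
have -> : [forall t : 'I_N.+2, falls (take t (rcons v b)) <= rises (take t (rcons v b))] =
  [forall t : 'I_N.+1, falls (take t v) <= rises (take t v)] &&
  (falls v + ~~ b <= rises v + b).
  apply/forallP/andP => [F | [/forallP F Fm]].
    split; last by have := F ord_max; rewrite /= Em Ef Er.
    by apply/forallP=> t; have := F (widen t); rewrite /= Et // -ltnS ltn_ord.
  elim/widen_ind => [t|]; last by rewrite /= Em Ef Er.
  by have := F t; rewrite /= Et // -ltnS ltn_ord.
case: (boolP [forall t : 'I_N.+1, _]) => [/forallP/(_ ord_max) | _];
  last by case: b {Et Ef Er Em}; rewrite ?andbF.
rewrite /= En; case: b {Et Ef Er Em} => /=; lia.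
Qed.

Local Open Scope ring_scope.

(** The ranks of the elements of [A] take each value below [#|A|] once. The induction splits off the
    largest index, which has the top rank if it belongs to [A]. *)
Lemma sum_rank (V : nmodType) (n : nat) (A : pred 'I_n) (phi : nat -> V) :
  \sum_(b | A b) phi #|[set j | A j & (j < b)%N]| = \sum_(r < #|A|) phi r.
Proof.
elim: n A => [|n IH] A; first by rewrite big_ord0 (_ : #|A| = 0%N) ?big_ord0 // eq_card0 // => -[].
have -> : #|A| = (#|A \o @widen n| + A ord_max)%N.
  by rewrite -cardsE (card_widen A) cardsE.
have Hlt (b : 'I_n) : #|[set j | A j & (j < widen b)%N]| =
    #|[set j | (A \o @widen n) j & (j < b)%N]|.
  by rewrite (card_widen (fun j => A j && (j < widen b)%N)) gt_max_widen andbF addn0.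
rewrite big_mkcond big_ord_recr /= -big_mkcond /=.
rewrite (eq_bigr (fun b : 'I_n => phi #|[set j | (A \o @widen n) j & (j < b)%N]|)); last first.
  by move=> b _; rewrite -Hlt.
rewrite (IH (A \o @widen n)); case: (A ord_max); last by rewrite addn0 addr0.
rewrite addn1 big_ord_recr /=; congr (_ + phi _).
rewrite (card_widen (fun j => A j && (j < n)%N)) /= ltnn andbF addn0 -[RHS]cardsE.
by apply: eq_card => j; rewrite !inE /= ltn_ord andbT.
Qed.

Lemma sum_option (V : nmodType) (T : finType) (F : option T -> V) :
  \sum_o F o = F None + \sum_x F (Some x).
Proof.
rewrite (bigD1 None) //=; congr (_ + _).
rewrite (reindex_omap Some id) => [|[] //].
by apply: eq_bigl => x; rewrite eqxx.
Qed.

(** * Insertion weights and the recurrence for [Qhat] *)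

Section Weights.
Variables (R : comNzRingType).
Variables (xe ye ue xo yo uo pm1 qm1 pm2 qm2 pp1 pp2 lambda : R).

Definition graph_weight (n : nat) (G : digraph n) : R :=
  let e := @even_vertex n in
  let o := @odd_vertex n in
    xe ^+ statA e G * ye ^+ statV e G * ue ^+ statB e G *
    xo ^+ statA o G * yo ^+ statV o G * uo ^+ statB o G *
    pm1 ^+ statC e G * qm1 ^+ statN e G * pp2 ^+ statL e G *
    pm2 ^+ statC o G * qm2 ^+ statN o G * pp1 ^+ statL o G *
    lambda ^+ cyc G.

Local Notation Q := (Qhat xe ye ue xo yo uo pm1 qm1 pm2 qm2 pp1 pp2 lambda).

(* [c] says whether the label of the inserted vertex is even. *)
Definition valley_factor (c : bool) (h : nat) : R :=
  if c then ye * pp2 ^+ h else yo * pp1 ^+ h.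

(** Here [r] and [s] count the sources below and above [b], that is, the nestings and crossings of
    the new peak; [r = 0] marks a record value. *)
Definition peak_factor (c : bool) (r s : nat) : R :=
  if c then (if r == 0%N then xe else ue) * pm1 ^+ s * qm1 ^+ r
  else (if r == 0%N then xo else uo) * pm2 ^+ s * qm2 ^+ r.

(** Total weight of the peak insertions into a digraph with [h + 1] paths: the first factor sums
    over the sink, the second over the rank of the source. *)
Definition fall_factor (c : bool) (h : nat) : R :=
  (lambda + h%:R) *
  if c then pm1 ^+ h * xe + qm1 * pq_int pm1 qm1 h * ue
  else pm2 ^+ h * xo + qm2 * pq_int pm2 qm2 h * uo.

Lemma even_vertex_max n : @even_vertex n.+1 ord_max = odd n.
Proof. by rewrite /even_vertex /label /= negbK. Qed.

Lemma odd_vertex_max n : @odd_vertex n.+1 ord_max = ~~ odd n.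
Proof. by []. Qed.

Lemma graph_weight_isolated (n : nat) (G : digraph n) : laguerre G ->
  graph_weight (insert_max G None None) =
  graph_weight G * valley_factor (odd n) #|sink G|.
Proof.
move=> lagG; rewrite /graph_weight.
rewrite !statA_insert // !statB_insert // !statV_insert // !statC_insert // !statN_insert //.
rewrite !statL_insert // cyc_insert // cyclic_rep_insert_m_isolated //.
rewrite peak_insert_m // valley_insert_m // ulev_insert_m // even_vertex_max odd_vertex_max.
rewrite -![@even_vertex _ \o _]/(@even_vertex n) -![@odd_vertex _ \o _]/(@odd_vertex n).
rewrite /valley_factor; case: (odd n); rewrite /= ?mul0n ?mul1n ?addn0 !exprD ?expr1 ?expr0;
  repeat (match goal with |- context [?x ^+ ?m] => generalize (x ^+ m) => ? end); ring.
Qed.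

Lemma graph_weight_peak (n : nat) (G : digraph n) (a b : 'I_n) :
  laguerre G -> source G b -> sink G a ->
  graph_weight (insert_max G (Some b) (Some a)) =
  graph_weight G * (peak_factor (odd n) #|[set j | source G j & (j < b)%N]|
    #|[set j | source G j & (b < j)%N]| * lambda ^+ connect (adj G) a b).
Proof.
move=> lagG sb sa; rewrite /graph_weight.
rewrite !statA_insert // !statB_insert // !statV_insert // !statC_insert // !statN_insert //.
rewrite !statL_insert // cyc_insert // (@cyclic_rep_insert_m _ _ _ _ _ _ _ a b) //.
rewrite peak_insert_m // valley_insert_m // (record_value_insert_m _ _ _ (b := b)) //.
rewrite (lcross_insert_m _ _ _ (b := b)) // (lnest_insert_m _ _ _ (b := b)) //.
rewrite even_vertex_max odd_vertex_max.
rewrite -![@even_vertex _ \o _]/(@even_vertex n) -![@odd_vertex _ \o _]/(@odd_vertex n).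
set r := #|_|; set s := #|_|.
rewrite /peak_factor; case: (odd n); case: (r == 0%N);
  rewrite /= ?mul0n ?mul1n ?addn0 !exprD ?expr1 ?expr0;
  repeat (match goal with |- context [?x ^+ ?m] => generalize (x ^+ m) => ? end); ring.
Qed.

(** Only the sink at the end of the path of [b] closes a cycle and gives [lambda]; each other sink
    gives 1. *)
Lemma sum_sink_connect (n : nat) (G : digraph n) (b : 'I_n) :
  laguerre G -> source G b ->
  \sum_(a | sink G a) lambda ^+ connect (adj G) a b = lambda + (#|sink G|.-1)%:R.
Proof.
move=> lagG sb; have [a sa ab] := source_connect_sink lagG sb.
rewrite (bigD1 a) //= ab expr1 (eq_bigr (fun _ => 1)) => [|a' /andP[sa' Na]]; last first.
  case: (boolP (connect _ a' b)) => [ab' | _]; last by rewrite expr0.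
  rewrite connect_adj_sym in ab'.
  by case/eqP: Na; apply: (sink_connect_uniq lagG sa' sa);
    rewrite connect_adj_sym (connect_trans ab).
rewrite sumr_const (cardD1 a (sink G)) [a \in sink G]sa /=; congr (_ + _%:R).
by apply: eq_card => x; rewrite !inE -topredE /= andbC.
Qed.

Lemma sum_peak_factor (c : bool) (h : nat) :
  (lambda + h%:R) * \sum_(r < h.+1) peak_factor c r (h - r) = fall_factor c h.
Proof.
have main x u p q :
  \sum_(r < h.+1) (if (r : nat) == 0%N then x else u) * p ^+ (h - r) * q ^+ r =
  p ^+ h * x + q * pq_int p q h * u :> R.
  rewrite big_ord_recl /= subn0 expr0 mulr1 mulrC; congr (_ + _).
  (* The terms with positive rank are listed in reverse, since the summation index of [pq_int] is
     the exponent of [p]. *)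
  rewrite /pq_int mulr_sumr mulr_suml (reindex_inj rev_ord_inj) /=.
  apply: eq_bigr => i _.
  have Hi := ltn_ord i.
  rewrite /bump /= add1n exprS.
  have -> : (h - (h - i.+1).+1 = i)%N by lia.
  have -> : (h - 1 - i = h - i.+1)%N by lia.
  ring.
by rewrite /fall_factor /peak_factor; congr (_ * _); case: c; rewrite main.
Qed.

Lemma sum_insertions (n k : nat) (G : digraph n) : G \in LDalt n k.+1 ->
  \sum_(b | source G b) \sum_(a | sink G a)
    graph_weight (insert_max G (Some b) (Some a)) =
  fall_factor (odd n) k * graph_weight G.
Proof.
rewrite inE => /and3P[lagG _ /eqP]; rewrite npathsE // => Hk.
rewrite (eq_bigr (fun b : 'I_n => graph_weight G * ((lambda + k%:R) *
   peak_factor (odd n) #|[set j | source G j & (j < b)%N]|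
    (k - #|[set j | source G j & (j < b)%N]|)))) => [|b sb].
  rewrite -!mulr_sumr (sum_rank (source G) (fun r => peak_factor (odd n) r (k - r))).
  by rewrite card_source_sink // Hk sum_peak_factor mulrC.
rewrite (eq_bigr _ (fun a sa => graph_weight_peak lagG sb sa)) -!mulr_sumr.
rewrite sum_sink_connect // card_lt_gt // card_source_sink // Hk; ring.
Qed.

Lemma Qhat_recurrence (n k : nat) :
  Q n.+1 k = (if k is k'.+1 then valley_factor (odd n) k' * Q n k' else 0) +
             fall_factor (odd n) k * Q n k.+1.
Proof.
pose ins (t : digraph n * (option 'I_n * option 'I_n)) := insert_max t.1 t.2.1 t.2.2.
pose del (G : digraph n.+1) := (restrict G, ([pick j | (ord_max, widen j) \in G],
    [pick i | (widen i, ord_max) \in G])).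
(* The sum now runs over an old digraph and two optional ends of the new edges. *)
rewrite [LHS](reindex_onto ins del); last exact: LDalt_insert_restrict.
rewrite (eq_bigl (fun t => ins t \in LDalt n.+1 k)); last first.
  case=> G [ob oa]; rewrite /del /ins /= restrict_insert_max pick_insert_max_ob.
  by rewrite pick_insert_max_oa eqxx andbT.
rewrite big_mkcond -(pair_bigA _ (fun G o => if insert_max G o.1 o.2 \in LDalt n.+1 k then
   graph_weight (insert_max G o.1 o.2) else 0)) /=.
(* Of the four cases for the two ends, the mixed ones vanish; an isolated vertex and a peak
   remain. *)
rewrite (eq_bigr (fun G =>
  (if (0 < k)%N && (G \in LDalt n k.-1) then graph_weight (insert_max G None None) else 0) +
  (if G \in LDalt n k.+1 then \sum_(b | source G b) \sum_(a | sink G a)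
    graph_weight (insert_max G (Some b) (Some a)) else 0))); last first.
  move=> G _.
  rewrite -(pair_bigA _ (fun ob oa => if insert_max G ob oa \in LDalt n.+1 k then
   graph_weight (insert_max G ob oa) else 0)) /= sum_option.
  rewrite sum_option insert_isolated_LDalt [X in _ + X + _]big1 ?addr0 => [|a _]; last first.
    by rewrite insert_half_LDalt.
  congr (_ + _); rewrite (eq_bigr (fun b : 'I_n => if (G \in LDalt n k.+1) && source G b then
     \sum_(a | sink G a) graph_weight (insert_max G (Some b) (Some a)) else 0)) => [|b _].
    by case: (G \in _) => /=; [rewrite [RHS]big_mkcond | rewrite big1].
  rewrite sum_option insert_half_LDalt // add0r.
  under eq_bigr => a _ do rewrite insert_peak_LDalt andbA.
  by case: (_ && _) => /=; [rewrite [RHS]big_mkcond | rewrite big1].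
rewrite big_split /=; congr (_ + _); last first.
  rewrite -big_mkcond mulr_sumr; apply: eq_bigr => G HG; exact: sum_insertions.
case: k => [|k] /=; first by rewrite big1.
rewrite -big_mkcond mulr_sumr; apply: eq_bigr => G.
rewrite inE => /and3P[lagG _ /eqP <-].
by rewrite graph_weight_isolated // npathsE // mulrC.
Qed.

End Weights.

(** * The recurrence for lattice paths *)

Lemma path_weight_rcons (R : comNzRingType) (alpha : nat -> R) (N : nat)
    (v : N.-tuple bool) (b : bool) :
  path_weight alpha (rcons_tuple v b) =
  path_weight alpha v * (if b then 1 else alpha (ht v N)).
Proof.
have Et t : (t <= N)%N -> ht (rcons v b) t = ht v t.
  by move=> Ht; rewrite /ht -cats1 takel_cat // size_tuple.
rewrite /path_weight big_mkcond big_ord_recr /= [in RHS]big_mkcond; congr (_ * _).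
  apply: eq_bigr => t _; rewrite !(tnth_nth false) /= nth_rcons size_tuple ltn_ord.
  by rewrite Et // ltnW.
by rewrite (tnth_nth false) /= nth_rcons size_tuple ltnn eqxx if_neg Et.
Qed.

(** The last step is a rise from height [H - 1] or a fall from height [H + 1]. *)
Lemma path_gf_recurrence (R : comNzRingType) (alpha : nat -> R) (N H : nat) :
  path_gf alpha N.+1 H =
  (if H is H'.+1 then path_gf alpha N H' else 0) + alpha H.+1 * path_gf alpha N H.+1.
Proof.
pose add_last (vb : N.-tuple bool * bool) := rcons_tuple vb.1 vb.2.
pose del_last (w : N.+1.-tuple bool) : N.-tuple bool * bool :=
  (belast_tuple (thead w) (behead_tuple w), last (thead w) (behead w)).
have del_lastK : cancel del_last add_last.
  by case/tupleP=> x t; apply: val_inj; rewrite /= theadE -lastI.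
have add_lastK : cancel add_last del_last.
  move=> [v b]; have := congr1 val (del_lastK (add_last (v, b))).
  case: (del_last _) => v' b' /= /rcons_inj[/val_inj -> ->] //.
rewrite /path_gf (reindex add_last); last by exists del_last => w _.
rewrite big_mkcond -(pair_bigA _ (fun v b => if lattice_path H (rcons_tuple v b)
  then path_weight alpha (rcons_tuple v b) else 0)) /= exchange_big big_bool /=.
congr (_ + _).
  case: H => [|H]; last rewrite [RHS]big_mkcond; last first.
    by apply: eq_bigr => v _; rewrite lattice_path_rcons path_weight_rcons mulr1.
  by apply: big1 => v _; rewrite lattice_path_rcons.
rewrite mulr_sumr [RHS]big_mkcond; apply: eq_bigr => v _.
rewrite lattice_path_rcons path_weight_rcons; case: ifP => // /andP[_ /eqP ->].
by rewrite mulrC.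
Qed.

Lemma path_gf0 (R : comNzRingType) (alpha : nat -> R) (H : nat) :
  path_gf alpha 0 H = (H == 0%N)%:R.
Proof.
have lp (w : 0.-tuple bool) : lattice_path H w = (H == 0%N).
  rewrite /lattice_path tuple0 [RHS]eq_sym -[RHS]andTb; congr (_ && _).
  by apply/forallP=> t.
rewrite /path_gf (eq_bigl _ _ lp); case: (H == _); last by rewrite big_pred0_eq.
by rewrite (big_pred1 [tuple]) => [|w]; rewrite /path_weight ?big_ord0 // [w]tuple0 /= eqxx.
Qed.

(** * Comparison of the two recurrences *)

Section ClosedForm.
Variables (R : comNzRingType).
Variables (xe ye ue xo yo uo pm1 qm1 pm2 qm2 pp1 pp2 lambda : R).
Local Notation Q := (Qhat xe ye ue xo yo uo pm1 qm1 pm2 qm2 pp1 pp2 lambda).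
Local Notation valley_factor := (valley_factor ye yo pp1 pp2).
Local Notation fall_factor := (fall_factor xe ue xo uo pm1 qm1 pm2 qm2 lambda).

Lemma Qhat0 k : Q 0 k = (k == 0%N)%:R.
Proof.
have all0 (G : digraph 0) : G = set0 by apply/setP=> -[[]].
have lag0 (G : digraph 0) : laguerre G by apply/forallP=> -[].
have card0 (A : pred 'I_0) : #|A| = 0%N by apply: eq_card0 => -[].
have inLD (G : digraph 0) : (G \in LDalt 0 k) = (k == 0%N).
  rewrite inE lag0 npathsE // card0 eq_sym (_ : alternating G) //.
  by apply/forallP=> -[].
rewrite [LHS](eq_bigl _ _ inLD); case: (k == _); last by rewrite big_pred0_eq.
rewrite (big_pred1 set0) => [|G]; last by rewrite [G]all0 /= eqxx.
rewrite /statA /statB /statV /statC /statN /statL cycE // !big_pred0; try by case.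
by rewrite !card0 !expr0 !mulr1.
Qed.

Variable alpha : nat -> R.
Hypothesis alphaE : forall h, alpha h.+1 = fall_factor (odd h.+1) h * valley_factor (odd h) h.

(** The product of valley factors turns one recurrence into the other: a rise from height [h] adds
    the factor of index [h], and a fall back to [h] removes it, which the same factor in
    [alpha h.+1] compensates. The recurrence for [Q] involves the parity of [n], [alpha] that of the
    height; they agree wherever [Q] is nonzero. *)
Lemma Qhat_path_gf n k : Q n k =
  if odd n == odd k then (\prod_(h < k) valley_factor (odd h) h) * path_gf alpha n k else 0.
Proof.
elim: n k => [|n IH] k.
  rewrite Qhat0 path_gf0; case: k => [|k]; first by rewrite big_ord0 mulr1.
  by rewrite mulr0; case: ifP.
rewrite Qhat_recurrence IH path_gf_recurrence /= alphaE /=.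
case: k => [|k]; rewrite ?IH /= ?eqb_negLR ?negbK.
  case: ifP => [/eqP ->|]; last by rewrite mulr0 addr0.
  by rewrite !add0r big_ord_recr big_ord0 /=; ring.
case: ifP => [/eqP -> | _]; last by rewrite !mulr0 addr0.
rewrite !big_ord_recr /=; ring.
Qed.

(** Even [h] contribute [yo * pp1 ^+ h] and odd [h] contribute [ye * pp2 ^+ h]. The even numbers
    below [2 * k] add up to [k * (k - 1)], the odd ones to [k ^ 2], and the further term [h = 2 * k]
    raises the first sum to [k * (k + 1)]. *)
Lemma prod_valley_factor k :
  \prod_(h < 2 * k) valley_factor (odd h) h =
    pp1 ^+ (k * (k - 1)) * pp2 ^+ (k ^ 2) * ye ^+ k * yo ^+ k /\
  \prod_(h < 2 * k + 1) valley_factor (odd h) h =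
    pp1 ^+ (k * (k + 1)) * pp2 ^+ (k ^ 2) * ye ^+ k * yo ^+ k.+1.
Proof.
have step j : \prod_(h < 2 * j) valley_factor (odd h) h =
    pp1 ^+ (j * (j - 1)) * pp2 ^+ (j ^ 2) * ye ^+ j * yo ^+ j ->
  \prod_(h < 2 * j + 1) valley_factor (odd h) h =
    pp1 ^+ (j * (j + 1)) * pp2 ^+ (j ^ 2) * ye ^+ j * yo ^+ j.+1.
  move=> E; rewrite addn1 big_ord_recr /= E /valley_factor oddM /= exprS.
  have -> : (j * (j + 1) = j * (j - 1) + 2 * j)%N by case: j {E}; nia.
  rewrite [in RHS]exprD; ring.
suff E : \prod_(h < 2 * k) valley_factor (odd h) h =
    pp1 ^+ (k * (k - 1)) * pp2 ^+ (k ^ 2) * ye ^+ k * yo ^+ k by split; last exact: step.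
elim: k => [|k /step IH]; first by rewrite muln0 big_ord0 !expr0 !mulr1.
have -> : (2 * k.+1 = (2 * k + 1).+1)%N by lia.
rewrite big_ord_recr /= IH /valley_factor oddD oddM /= (exprS ye) (exprS yo).
have -> : (k.+1 * (k.+1 - 1) = k * (k + 1))%N by lia.
have -> : (k.+1 ^ 2 = k ^ 2 + (2 * k + 1))%N by nia.
rewrite [in RHS]exprD; ring.
Qed.

End ClosedForm.

Theorem theorem6p15 (R : comNzRingType)
    (xe ye ue xo yo uo pm1 qm1 pm2 qm2 pp1 pp2 lambda : R)
    (alpha : nat -> R)
    (alpha_odd : forall m : nat, (1 <= m)%N ->
       alpha (2 * m - 1)%N =
         (lambda + (2 * m - 2)%:R) *
         (pm1 ^+ (2 * m - 2) * xe + qm1 * pq_int pm1 qm1 (2 * m - 2) * ue) *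
         pp1 ^+ (2 * m - 2) * yo)
    (alpha_even : forall m : nat, (1 <= m)%N ->
       alpha (2 * m)%N =
         (lambda + (2 * m - 1)%:R) *
         (pm2 ^+ (2 * m - 1) * xo + qm2 * pq_int pm2 qm2 (2 * m - 1) * uo) *
         pp2 ^+ (2 * m - 1) * ye)
    (n k : nat) :
  let Q := Qhat xe ye ue xo yo uo pm1 qm1 pm2 qm2 pp1 pp2 lambda in
  Q (2 * n)%N (2 * k)%N =
    pp1 ^+ (k * (k - 1)) * pp2 ^+ (k ^ 2) * ye ^+ k * yo ^+ k *
    S_poly alpha n k
  /\
  Q (2 * n + 1)%N (2 * k + 1)%N =
    pp1 ^+ (k * (k + 1)) * pp2 ^+ (k ^ 2) * ye ^+ k * yo ^+ k.+1 *
    S'_poly alpha n k.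
Proof.
have alphaE h : alpha h.+1 =
    fall_factor xe ue xo uo pm1 qm1 pm2 qm2 lambda (odd h.+1) h *
    valley_factor ye yo pp1 pp2 (odd h) h.
  rewrite /fall_factor /valley_factor /=.
  (* With [m = h./2 + 1], the index [h + 1] is [2 * m] for odd [h] and [2 * m - 1] for even [h]. *)
  have := odd_double_half h; rewrite -muln2 mulnC; case: (odd h) => /= Eh.
    have := alpha_even h./2.+1 isT; have -> : (2 * h./2.+1 - 1 = h)%N by lia.
    have -> : (2 * h./2.+1 = h.+1)%N by lia.
    by move=> ->; ring.
  have := alpha_odd h./2.+1 isT; have -> : (2 * h./2.+1 - 2 = h)%N by lia.
  have -> : (2 * h./2.+1 - 1 = h.+1)%N by lia.
  by move=> ->; ring.
have [E1 E2] := prod_valley_factor ye yo pp1 pp2 k.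
split; first by rewrite (Qhat_path_gf alphaE) E1 !oddM.
by rewrite (Qhat_path_gf alphaE) E2 /S'_poly !(addn1 (2 * _)) /= !oddM.
Qed.
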